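(* The deformed $q$-analog of the series $\sum_{n=0}^{\infty}\binom{2n}{n}\frac{(-1)^n}{2^{2n}(2n-1)}x^n=\sqrt{1+x}$ is $$\sum_{n=0}^{\infty}\genfrac{[}{]}{0pt}{}{2n}{n}_{q}\frac{(-1)^{n}(-u/t)^{\binom{n}{2}}}{(-q;q)_{n}(-\sqrt{q};q)_{n}(1-\sqrt{q}^{\,2n-1})}(\varphi_{s,t}^{-3/2}\sqrt{-t}\,x)^n=\frac{\sqrt{-t}}{(1-\sqrt{q})\sqrt{\varphi_{s,t}}}\;{}_{1}\Phi_{0}\left(\begin{array}{c} \sqrt{q^{-1}} \\ - \end{array};q,-\frac{u}{t},-\varphi_{s,t}^{-1/2}\sqrt{q}\,x\right).$$
   Context: Here $s,t$ are parameters, $\varphi_{s,t}=\frac{s+\sqrt{s^2+4t}}{2}$, $\varphi_{s,t}'=s-\varphi_{s,t}=-\frac{t}{\varphi_{s,t}}=\frac{s-\sqrt{s^2+4t}}{2}$, and $q=\varphi_{s,t}'/\varphi_{s,t}$; $u$ is the deformation parameter and $x$ is the variable. $(a;q)_0=1$ and $(a;q)_n=\prod_{k=0}^{n-1}(1-aq^k)$ for $n\ge1$. The $q$-binomial coefficient is $\genfrac{[}{]}{0pt}{}{n}{k}_{q}=\frac{(q;q)_n}{(q;q)_k(q;q)_{n-k}}$. The deformed basic hypergeometric series ${}_1\Phi_0$ is ${}_{1}\Phi_{0}\left(\begin{array}{c} a \\ - \end{array};q,v,z\right)=\sum_{n=0}^{\infty}v^{\binom n2}\frac{(a;q)_n}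{(q;q)_n}z^n$.
   Formalization: The printed prefactor is false (at s=5, t=-4, x=0: -1 versus 2); it is corrected to -√(-t)/((1-√q)φ), with square roots chosen so that √q=√(-t)/φ, t≠0 and q not a root of unity; the quoted classical series (whose sum is really -√(1+x)) is not formalized. *)

(* Defs.v *)
(* MathComp / MathComp-Analysis world. *)
From mathcomp Require Import all_boot all_order all_algebra.
From mathcomp Require Import complex.
From mathcomp Require Import classical_sets reals topology normedtype sequences.
Import Order.TTheory GRing.Theory Num.Theory numFieldNormedType.Exports.

Set Implicit Arguments.
Unset Strict Implicit.
Unset Printing Implicit Defensive.

Local Open Scope ring_scope.
Local Open Scope classical_set_scope.

Section QSeries.
Variable K : numFieldType.
Implicit Types a q v z s r : K.

(* [r] is the chosen square root of [s ^+ 2 + 4 * t]. *)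
Definition phi_st s r : K := (s + r) / 2.
Definition phi'_st s r : K := s - phi_st s r.
Definition q_st s r : K := phi'_st s r / phi_st s r.

Definition qpoch a q (n : nat) : K := \prod_(k < n) (1 - a * q ^+ k).

Definition qbinom q (n k : nat) : K :=
  qpoch q q n / (qpoch q q k * qpoch q q (n - k)).

Definition Phi10_coef a q v (n : nat) : K :=
  v ^+ 'C(n, 2) * (qpoch a q n / qpoch q q n).

(* [K^o] is [K] as a normed module over itself, i.e. with the topology of its
   norm. *)
Definition pseries (c : nat -> K) z : K^o ^nat :=
  series (fun n => c n * z ^+ n : K^o).

(* Meaningful only when the series converges. *)
Definition Phi10 a q v z : K^o := limn (pseries (Phi10_coef a q v) z).

End QSeries.

(* Main.v *)
Require Import Defs.
From mathcomp Require Import all_boot all_order all_algebra.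
From mathcomp Require Import complex.
From mathcomp Require Import classical_sets reals topology normedtype sequences.
From mathcomp Require boolp.
From mathcomp Require Import ring.
Import Order.TTheory GRing.Theory Num.Theory numFieldNormedType.Exports.

Local Open Scope ring_scope.
Local Open Scope classical_set_scope.

(** Write [p] for the chosen square root of [q] and [v = - u / t].  The branch
    condition reads [sqrtNt = p * phi], so the variables of the two series are
    [y = p / sqrtphi] and [z = - y], and the constant is [- (p / (1 - p))].
    Everything then reduces to one identity between coefficients, in which the
    factors [v ^+ 'C(n, 2)] and [(-1) ^+ n] match and [phi] has disappeared:
<<
      [2n, n]_q / ((-q; q)_n (-p; q)_n (1 - p^(2n-1)))
        = - p / (1 - p) * (1/p; q)_n / (q; q)_n.
>>
    Two facts about q-shifted factorials give it.  The 2n factors of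
    [(q; q)_2n] are the [1 - p^(2j)], [1 <= j <= 2n]; each splits as
    [(1 - p^j) (1 + p^j)], and sorting by the parity of [j] yields
    [(q; q)_2n = (p; q)_n (-p; q)_n (q; q)_n (-q; q)_n] ([qpoch_double]),
    so that the left-hand side is [(p; q)_n / ((q; q)_n (1 - p^(2n-1)))].
    Secondly [(1/p; q)_(n+1)] can be split at its first or at its last factor,
    which gives [(1/p; q)_n (1 - p^(2n-1)) = (1 - 1/p) (p; q)_n]
    ([qpoch_invM]), and [- p / (1 - p) * (1 - 1/p) = 1].

    Termwise the left series is thus the right one times the constant, which
    is nonzero; hence the two converge together and the sums are
    proportional ([cvgn_pseries_proportional],
    [limn_pseries_proportional]). *)

Lemma qpoch0 (K : numFieldType) (a q : K) : qpoch a q 0 = 1.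
Proof. by rewrite /qpoch big_ord0. Qed.

Lemma qpochSr (K : numFieldType) (a q : K) n :
  qpoch a q n.+1 = qpoch a q n * (1 - a * q ^+ n).
Proof. by rewrite /qpoch big_ord_recr. Qed.

Lemma qpochSl (K : numFieldType) (a q : K) n :
  qpoch a q n.+1 = (1 - a) * qpoch (a * q) q n.
Proof.
rewrite /qpoch big_ord_recl expr0 mulr1; congr (_ * _).
by apply: eq_bigr => i _; rewrite exprS mulrA.
Qed.

Lemma qpoch_neq0 (K : numFieldType) (a q : K) n :
  (forall k, a * q ^+ k != 1) -> qpoch a q n != 0.
Proof. by move=> aqk; apply/prodf_neq0 => k _; rewrite subr_eq0 eq_sym. Qed.

(** Each step from [n] to [n.+1] contributes [1 - p ^+ (2 * j)] for
    [j = 2n+1] and [j = 2n+2] on the left, and on the right the factors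
    [1 - p ^+ j] and [1 + p ^+ j] of both. *)
Lemma qpoch_double (K : numFieldType) (p : K) n :
  let q := p ^+ 2 in
  qpoch q q (2 * n) =
    qpoch p q n * qpoch (- p) q n * qpoch q q n * qpoch (- q) q n.
Proof.
move=> q; elim: n => [|n IHn]; first by rewrite muln0 !qpoch0 !mulr1.
rewrite mulnS !addSn add0n !qpochSr {}IHn.
have -> : q ^+ (2 * n).+1 = q * (q ^+ n) ^+ 2 by rewrite exprS mulnC exprM.
have -> : q ^+ (2 * n) = (q ^+ n) ^+ 2 by rewrite mulnC exprM.
by rewrite /q; ring.
Qed.

(** Both sides are [(1/p; q)_(n+1)], split at its last and first factor. *)
Lemma qpoch_invM (K : numFieldType) (p : K) n : p != 0 ->
  qpoch p^-1 (p ^+ 2) n * (1 - p ^ ((2 * n)%:Z - 1)) =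
    (1 - p^-1) * qpoch p (p ^+ 2) n.
Proof.
move=> p0; have -> : p ^ ((2 * n)%:Z - 1) = p^-1 * (p ^+ 2) ^+ n.
  by rewrite expfzDr // exprN1 mulrC -exprnP exprM.
by rewrite -qpochSr qpochSl expr2 mulKf.
Qed.

(** No denominator vanishes: [1 + q^j = 0] or [p^m = 1] or [p^m = -1] would
    each make [q = p ^+ 2] a root of unity. *)
Lemma qbinom_central_coef (K : numFieldType) (p v : K) n :
  let q := p ^+ 2 in p != 0 -> (forall k, (0 < k)%N -> q ^+ k != 1) ->
  qbinom q (2 * n) n * ((-1) ^+ n * v ^+ 'C(n, 2)) /
    (qpoch (- q) q n * qpoch (- p) q n * (1 - p ^ ((2 * n)%:Z - 1))) =
  - (p / (1 - p)) * ((-1) ^+ n * Phi10_coef p^-1 q v n).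
Proof.
move=> q p0 qk.
have pk m (e : K) : (0 < m)%N -> e ^+ 2 = 1 -> e * p ^+ m != 1.
  move=> m0 e2; apply: contra (qk m m0) => /eqP em.
  have : (e * p ^+ m) ^+ 2 = 1 by rewrite em expr1n.
  by rewrite exprMn e2 mul1r -exprM mulnC exprM => ->.
have pow k : p * q ^+ k = p ^+ (2 * k).+1 by rewrite exprS exprM.
have qq : qpoch q q n != 0.
  by apply: qpoch_neq0 => k; rewrite -exprS qk.
have Nqq : qpoch (- q) q n != 0.
  apply: qpoch_neq0 => k; rewrite mulNr -exprS -exprM -mulN1r.
  by rewrite pk // sqrrN expr1n.
have Npq : qpoch (- p) q n != 0.
  by apply: qpoch_neq0 => k; rewrite mulNr pow -mulN1r pk // sqrrN expr1n.
have pq : qpoch p q n != 0.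
  by apply: qpoch_neq0 => k; rewrite pow -[_ ^+ _]mul1r pk // expr1n.
have p1 : 1 - p != 0.
  rewrite subr_eq0 eq_sym; have := pk 1%N 1 isT (expr1n _ _).
  by rewrite mul1r expr1.
have inv1 : 1 - p^-1 != 0.
  by apply: contra p1; rewrite !subr_eq0 => /eqP e; rewrite -[p]invrK -e invr1.
have qinv := qpoch_invM K p n p0.
(* the exponent is -1 for n = 0; [qpoch_invM] treats all n uniformly *)
have last0 : 1 - p ^ ((2 * n)%:Z - 1) != 0.
  apply: contraTneq isT => e; move: qinv; rewrite e mulr0 => /esym/eqP.
  by rewrite mulf_eq0 (negPf inv1) (negPf pq).
rewrite /qbinom mul2n -addnn addnK addnn -mul2n qpoch_double -/q /Phi10_coef.
rewrite -[qpoch p^-1 q n](mulfK last0) qinv -/q.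
by field; rewrite p0 qq p1 last0 Nqq Npq.
Qed.

(** The hypotheses on [phi] and [sqrtNt] enter here only: [sqrtNt] is
    [sqrtq * phi], and [phi] is a factor of [- t = phi * (s - phi)], so that
    [phi], [sqrtphi] and [sqrtq] are nonzero. *)
Lemma deformed_sqrt_coef (K : numFieldType) (s t v : K)
    (sqrtD sqrtphi sqrtNt sqrtq : K) :
  let phi := phi_st s sqrtD in
  let q := q_st s sqrtD in
  let const := - (sqrtNt / ((1 - sqrtq) * phi)) in
  sqrtD ^+ 2 = s ^+ 2 + 4 * t -> sqrtphi ^+ 2 = phi -> sqrtNt ^+ 2 = - t ->
  sqrtq ^+ 2 = q -> sqrtq = sqrtNt / phi -> t != 0 ->
  (forall k, (0 < k)%N -> q ^+ k != 1) ->
  const != 0 /\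
  forall n,
    qbinom q (2 * n) n * ((-1) ^+ n * v ^+ 'C(n, 2)) /
      (qpoch (- q) q n * qpoch (- sqrtq) q n *
       (1 - sqrtq ^ ((2 * n)%:Z - 1))) * (sqrtphi ^- 3 * sqrtNt) ^+ n =
    const * (Phi10_coef sqrtq^-1 q v n * (- (sqrtphi^-1 * sqrtq)) ^+ n).
Proof.
move=> phi q const hsqrtD hsqrtphi hsqrtNt hsqrtq hbranch ht hq.
have phi0 : phi != 0.
  apply: contraNneq ht => phi0; rewrite -oppr_eq0.
  have -> : - t = phi * (s - phi); last by rewrite phi0 mul0r.
  transitivity ((s ^+ 2 - sqrtD ^+ 2) / 4); first by rewrite hsqrtD; field.
  by rewrite /phi /phi_st; field.
clearbody phi q.
have NtE : sqrtNt = sqrtq * phi by rewrite hbranch divfK.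
have sqrtq0 : sqrtq != 0.
  apply: contraNneq ht => q0; rewrite -oppr_eq0 -hsqrtNt NtE q0 mul0r.
  by rewrite expr0n.
have sqrtphi0 : sqrtphi != 0.
  by apply: contraNneq phi0 => e; rewrite -hsqrtphi e expr0n.
have sqrtq1 : 1 - sqrtq != 0.
  rewrite subr_eq0; apply: contraNneq (hq 1%N isT) => e.
  by rewrite -hsqrtq -e !expr1n.
have constE : const = - (sqrtq / (1 - sqrtq)).
  by rewrite /const NtE; field; rewrite phi0 sqrtq1.
split=> [|n]; first by rewrite constE oppr_eq0 mulf_neq0 // invr_eq0.
have -> : sqrtphi ^- 3 * sqrtNt = sqrtphi^-1 * sqrtq.
  by rewrite NtE -hsqrtphi; field.
rewrite -hsqrtq qbinom_central_coef //; last by rewrite hsqrtq.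
by rewrite -constE [(- (_ * _)) ^+ n]exprNn; ring.
Qed.

Lemma pseries_proportional (K : numFieldType) (c d : nat -> K) (k y z x : K) :
  (forall n, c n * y ^+ n = k * (d n * z ^+ n)) ->
  pseries c (y * x) = k \*: pseries d (z * x).
Proof.
move=> cd; apply/boolp.funext => m.
rewrite /pseries /series /= scaler_sumr; apply: eq_bigr => i _.
rewrite !exprMn /GRing.scale /=.
by have := congr1 ( *%R^~ (x ^+ i)) (cd i); rewrite /= -!mulrA.
Qed.

Lemma cvgn_pseries_proportional (K : numFieldType) (c d : nat -> K)
    (k y z x : K) : k != 0 ->
  (forall n, c n * y ^+ n = k * (d n * z ^+ n)) ->
  cvgn (pseries c (y * x)) <-> cvgn (pseries d (z * x)).
Proof.
move=> k0 cd; rewrite (pseries_proportional _ _ _ _ _ _ x cd).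
by rewrite is_cvgZlE.
Qed.

Lemma limn_pseries_proportional (K : numFieldType) (c d : nat -> K)
    (k y z x : K) :
  (forall n, c n * y ^+ n = k * (d n * z ^+ n)) ->
  cvgn (pseries d (z * x)) ->
  limn (pseries c (y * x)) = k * limn (pseries d (z * x)).
Proof.
by move=> cd cvd; rewrite (pseries_proportional _ _ _ _ _ _ x cd) limZl_tmp.
Qed.

Theorem theorem4 (R : realType) (s t u : R[i])
    (sqrtD sqrtphi sqrtNt sqrtq : R[i])
    (hsqrtD : sqrtD ^+ 2 = s ^+ 2 + 4 * t) :
  let phi := phi_st s sqrtD in
  let q := q_st s sqrtD in
  forall (hsqrtphi : sqrtphi ^+ 2 = phi)
    (hsqrtNt : sqrtNt ^+ 2 = - t)
    (hsqrtq : sqrtq ^+ 2 = q)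
    (hbranch : sqrtq = sqrtNt / phi)
    (ht : t != 0)
    (hq : forall k : nat, (0 < k)%N -> q ^+ k != 1),
  let lhs_coef := fun n : nat =>
    qbinom q (2 * n) n * ((-1) ^+ n * (- u / t) ^+ 'C(n, 2)) /
      (qpoch (- q) q n * qpoch (- sqrtq) q n *
       (1 - sqrtq ^ ((2 * n)%:Z - 1))) in
  let rhs_coef := Phi10_coef sqrtq^-1 q (- u / t) in
  let const := - (sqrtNt / ((1 - sqrtq) * phi)) in
  let y := sqrtphi ^- 3 * sqrtNt in
  let z := - (sqrtphi^-1 * sqrtq) in
  (* the identity of formal power series in the variable *)
  (forall n : nat, lhs_coef n * y ^+ n = const * (rhs_coef n * z ^+ n)) /\
  (* the identity of sums, at every point where the series converge *)
  (forall x : R[i],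
     (cvgn (pseries lhs_coef (y * x)) <-> cvgn (pseries rhs_coef (z * x))) /\
     (cvgn (pseries rhs_coef (z * x)) ->
        limn (pseries lhs_coef (y * x)) =
          const * Phi10 sqrtq^-1 q (- u / t) (z * x))).
Proof.
move=> phi q hsqrtphi hsqrtNt hsqrtq hbranch ht hq.
have [const0 coefE] := deformed_sqrt_coef _ _ _ (- u / t) _ _ _ _
  hsqrtD hsqrtphi hsqrtNt hsqrtq hbranch ht hq.
split; first exact: coefE.
move=> x; split.
  exact: (cvgn_pseries_proportional _ _ _ _ _ _ _ const0 coefE).
apply: limn_pseries_proportional; exact: coefE.
Qed.
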